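(* Let $\kappa,\lambda,\mu$ be infinite cardinals with $\kappa=\lambda+\mu$. Then there is a topology $\tau$ on $\kappa$ such that: (a) the posets $\langle [\tau]_{\cong},\subseteq\rangle$ and $\langle [\kappa]^{\lambda|\mu},\subseteq\rangle$ are isomorphic; (b) for any linear order $L$: (i) if $\kappa=\lambda=\mu$, then there is a maximal chain $\mathcal{L}$ in $\langle[\tau]_{\cong},\subseteq\rangle$ with $\mathcal{L}\cong L$ if and only if $L$ is weakly Boolean and $w((-\infty,a]_L)=w([a,\infty)_L)=\kappa$ for each $a\in L$; (ii) if $\lambda<\kappa$, then there is a maximal chain $\mathcal{L}$ in $\langle[\tau]_{\cong},\subseteq\rangle$ with $\mathcal{L}\cong L$ if and only if $L$ is weakly Boolean and $w((-\infty,a]_L)=\lambda$ and $w([a,\infty)_L)=\lambda^+$ for each $a\in L$; (iii) if $\mu<\kappa$, then there is a maximal chain $\mathcal{L}$ in $\langle[\tau]_{\cong},\subseteq\rangle$ with $\mathcal{L}\cong L$ if and only if $L$ is weakly Boolean and $w((-\infty,a]_L)=\mu^+$ and $w([a,\infty)_L)=\mu$ for each $a\in L$.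
   Context: $\mathrm{Top}_\kappa$ is the set of all topologies on the set $\kappa$; for $\tau\in\mathrm{Top}_\kappa$, $[\tau]_{\cong}=\{\sigma\in\mathrm{Top}_\kappa: \sigma \text{ is homeomorphic to } \tau\}$ (i.e. $(\kappa,\sigma)$ and $(\kappa,\tau)$ are homeomorphic spaces). $[\kappa]^{\lambda|\mu}=\{A\subseteq\kappa: |A|=\lambda,\ |\kappa\setminus A|=\mu\}$. A linear order $L$ is weakly Boolean if it is Dedekind-complete (every nonempty subset bounded above has a supremum) and has dense jumps (for all $a<b$ there are $c<d$ in $[a,b]_L$ with $(c,d)_L=\emptyset$). $D\subseteq L$ is weakly dense if for all $x<y$ in $L$ there is $z\in D$ with $x\le z\le y$; $w(L)$ is the minimal size of a weakly dense subset of $L$. $(-\infty,a]_L$ and $[a,\infty)_L$ denote the initial and final segments determined by $a$, with the induced order. *)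

(* Defs.v *)
From HB Require Import structures.
From mathcomp Require Import all_boot all_order interval.
From mathcomp Require Import boolp classical_sets functions cardinality.
From mathcomp Require Import set_interval topology.

Set Implicit Arguments.
Unset Strict Implicit.
Unset Printing Implicit Defensive.

Import Order.TTheory.
Local Open Scope classical_set_scope.
Local Open Scope card_scope.

(* A cardinal is represented by a set (possibly a full type [set: K]) of that
   cardinality; equalities and inequalities of cardinals are #= and #<=. *)

Definition card_lt T U (A : set T) (B : set U) : Prop :=
  A #<= B /\ ~ (B #<= A).

(* |B| = |A|^+ : B has the least cardinality strictly above that of A. *)
Definition card_succ T U (A : set T) (B : set U) : Prop :=
  card_lt A B /\
  forall (V : Type) (C : set V), card_lt A C -> B #<= C.

(* [kappa]^{lambda|mu}, with kappa, lambda, mu represented by K, Lam, Mu. *)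
Definition split_sets (K Lam Mu : Type) : set (set K) :=
  [set A | A #= [set: Lam] /\ ~` A #= [set: Mu]].
Arguments split_sets : clear implicits.

(* The empty set is open by open_bigcup with F := set0. *)
Record topology (K : Type) := Topology {
  opens :> set (set K);
  open_full : opens [set: K];
  open_inter : setI_closed opens;
  open_bigcup : forall F : set (set K),
    F `<=` opens -> opens (\bigcup_(U in F) U)
}.

Definition space (K : Type) (t : topology K) : Type := K.

Section Space.
Variables (K : Type) (t : topology K).

Lemma opens_bigcupT (I : Type) (f : I -> set (space t)) :
  (forall i, opens t (f i)) -> opens t (\bigcup_i f i).
Proof.
move=> tf; have -> : \bigcup_i f i = \bigcup_(U in range f) U.
  by rewrite bigcup_image.
by apply: open_bigcup => _ [i _ <-].
Qed.

HB.instance Definition _ := gen_eqMixin (space t).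
HB.instance Definition _ := gen_choiceMixin (space t).
HB.instance Definition _ := isOpenTopological.Build (space t)
  (@open_full K t) (@open_inter K t) opens_bigcupT.

Lemma open_spaceE (U : set (space t)) : open U = opens t U.
Proof. by []. Qed.

End Space.

Definition homeomorphic (K : Type) (s t : topology K) : Prop :=
  exists (f : space s -> space t) (g : space t -> space s),
    [/\ cancel f g, cancel g f, continuous f & continuous g].

(* The class of t, each topology being identified with its family of open
   sets, so that the order on topologies is inclusion. *)
Definition homeo_class (K : Type) (t : topology K) : set (set (set K)) :=
  @opens K @` [set s | homeomorphic s t].

Definition poset_iso (T U : Type) (A : set T) (rA : T -> T -> Prop)
    (B : set U) (rB : U -> U -> Prop) : Prop :=
  exists2 f : T -> U, set_bij A B f &
    forall x y, A x -> A y -> (rA x y <-> rB (f x) (f y)).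

Definition maximal_chain (T : Type) (P C : set (set T)) : Prop :=
  [/\ C `<=` P, total_on C subset &
      forall C' : set (set T),
        C' `<=` P -> total_on C' subset -> C `<=` C' -> C' = C].

Section LinearOrders.
Context {d : Order.disp_t} (L : orderType d).
Local Open Scope order_scope.

Definition dedekind_complete : Prop :=
  forall A : set L, A !=set0 -> has_ubound A -> supremums A !=set0.

Definition dense_jumps : Prop :=
  forall a b : L, a < b ->
    exists c e : L, [/\ a <= c, c < e, e <= b & `]c, e[%classic = set0].

Definition weakly_boolean : Prop := dedekind_complete /\ dense_jumps.

(* D is weakly dense in the suborder X of L. *)
Definition weakly_dense (X D : set L) : Prop :=
  D `<=` X /\
  forall x y, X x -> X y -> x < y -> exists2 z, D z & x <= z <= y.

(* D is a weakly dense subset of X of least cardinality: w(X) = |D|. *)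
Definition min_weakly_dense (X D : set L) : Prop :=
  weakly_dense X D /\ forall D', weakly_dense X D' -> D #<= D'.

(* w(X) is the cardinality of A. *)
Definition weight_is (X : set L) (U : Type) (A : set U) : Prop :=
  exists2 D, min_weakly_dense X D & D #= A.

(* w(X) is the successor of the cardinality of A. *)
Definition weight_is_succ (X : set L) (U : Type) (A : set U) : Prop :=
  exists2 D, min_weakly_dense X D & card_succ A D.

Definition has_maximal_chain_iso (T : Type) (P : set (set T)) : Prop :=
  exists2 C, maximal_chain P C &
    poset_iso C subset [set: L] (fun x y => x <= y).

End LinearOrders.

(* Main.v *)
Require Import Defs.
From mathcomp Require Import all_boot all_order interval.
From mathcomp Require Import boolp classical_sets functions cardinality.
From mathcomp Require Import set_interval topology.

(** A set [A] of the prescribed size and co-size is coded by the topology whose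
    proper open sets are the subsets of [A]; its homeomorphism class is the
    poset of all such sets, so everything reduces to maximal chains of sets.
    In a maximal chain, every point [x] that some members contain and others
    omit determines a jump, from the union of the members omitting [x] to the
    intersection of those containing [x], and two consecutive members differ
    by one point. Weights therefore count points: the weight of an initial
    segment is the size of its top member minus the intersection of the chain,
    and the weight of a final segment is the size of the union of the chain
    minus the bottom member. Maximality forces the intersection and the union
    of the chain out of the poset, which determines these cardinals.
    Conversely, a weakly Boolean order embeds in the subsets of its set of
    jumps by sending [a] to the set of jumps below [a], and Dedekind
    completeness makes this chain maximal. *)

Set Implicit Arguments.
Unset Strict Implicit.
Unset Printing Implicit Defensive.

Import Order.TTheory.
Local Open Scope classical_set_scope.
Local Open Scope card_scope.

(** * Cardinal arithmetic *)

(** A relation need not be defined outside [A], so this form also covers an empty target type and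
    lets later proofs give graphs instead of functions. Choice recovers an injection. *)
Lemma card_le_relP {T U : Type} {A : set T} {B : set U} :
  A #<= B <-> exists R : T -> U -> Prop,
    (forall a, A a -> exists2 b, B b & R a b) /\
    (forall a a' b, A a -> A a' -> B b -> R a b -> R a' b -> a = a').
Proof.
elim/Ppointed: U => U in B *.
  split=> [|[R [Rtot _]]].
    rewrite (empty_eq0 B) => /card_le0P ->.
    by exists (fun _ _ => False); split.
  have -> : A = set0.
    by apply/seteqP; split=> // a /Rtot[b]; rewrite (empty_eq0 B).
  exact: card_ge0.
split=> [/pcard_leP[f]|[R [Rtot Rinj]]].
  exists (fun a b => b = f a); split=> [a Aa|a a' b Aa Aa' _ -> ffE].
    by exists (f a) => //; exact: funS.
  by apply: (@inj _ _ _ f) => //; rewrite inE.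
pose f a := xget point (fun b => B b /\ R a b).
have fP a : A a -> B (f a) /\ R a (f a).
  move=> /Rtot[b Bb Rab]; rewrite /f; case: xgetP => // /(_ b) nP.
  by exfalso; apply: nP.
apply/pcard_leP/injfunPex; exists f => [a /fP[]//|a a'].
rewrite !inE => Aa Aa' ffE; have [Bf Ra] := fP _ Aa; have [_ Ra'] := fP _ Aa'.
by apply: (Rinj a a' (f a)) => //; rewrite ffE.
Qed.

(** Zorn's lemma yields a maximal partial injection [G]. If it missed both some [a] in [A] and some
    [b] in [B], adding [(a, b)] would enlarge it. *)
Lemma card_le_total {T U : Type} (A : set T) (B : set U) : A #<= B \/ B #<= A.
Proof.
pose P (G : set (T * U)) := G `<=` A `*` B /\
  forall p q, G p -> G q -> p.1 = q.1 <-> p.2 = q.2.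
have [|G [[GAB Gbij] Gmax]] := @Zorn_bigcup _ P.
  move=> F FP Ftot; split=> [p [G FG Gp]|p q [G FG Gp] [H FH Hq]].
    exact: (FP _ FG).1.
  have [GH|HG] := Ftot _ _ FG FH.
    by apply: (FP _ FH).2 => //; exact: GH.
  by apply: (FP _ FG).2 => //; exact: HG.
have [Acov|/existsNP[a /not_implyP[Aa na]]] :=
  pselect (forall a, A a -> exists b, G (a, b)).
  left; apply/card_le_relP; exists (fun a b => G (a, b)); split.
    by move=> a /Acov[b Gab]; exists b => //; have [] := GAB _ Gab.
  by move=> a a' b _ _ _ Gab Ga'b; apply/(Gbij _ _ Gab Ga'b).
have [Bcov|/existsNP[b /not_implyP[Bb nb]]] :=
  pselect (forall b, B b -> exists a, G (a, b)).
  right; apply/card_le_relP; exists (fun b a => G (a, b)); split.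
    by move=> b /Bcov[a' Gab]; exists a' => //; have [] := GAB _ Gab.
  by move=> b b' a' _ _ _ Gab Gab'; apply/(Gbij _ _ Gab Gab').
have na' p : G p -> p.1 <> a.
  by case: p => x y /= Gp xa; apply: na; exists y; rewrite -xa.
have nb' p : G p -> p.2 <> b.
  by case: p => x y /= Gp xa; apply: nb; exists x; rewrite -xa.
exfalso; apply: (Gmax (G `|` [set (a, b)])).
  split; first exact: subsetUl.
  by move=> /(_ (a, b) (or_intror erefl)) /na'.
split=> [p [/GAB//|->//]|p q [Gp|->] [Gq|->]] //=; first exact: Gbij.
- by split=> [/(na' _ Gp)|/(nb' _ Gp)].
- by split=> /esym => [/(na' _ Gq)|/(nb' _ Gq)].
Qed.

Lemma card_leX {T T' U U' : Type} {A : set T} {A' : set T'} {B : set U}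
    {B' : set U'} :
  A #<= A' -> B #<= B' -> A `*` B #<= A' `*` B'.
Proof.
move=> /card_le_relP[R [Rtot Rinj]] /card_le_relP[S [Stot Sinj]].
apply/card_le_relP; exists (fun p q => R p.1 q.1 /\ S p.2 q.2); split.
  move=> [a b] /= [/Rtot[a' Aa' Raa'] /Stot[b' Bb' Sbb']].
  by exists (a', b').
move=> [a b] [c d] [e f] /= [Aa Bb] [Ac Bd] [Ae Bf] [Rae Sbf] [Rce Sdf].
by congr pair; [exact: (Rinj _ _ e)|exact: (Sinj _ _ f)].
Qed.

(** The boolean records which of the two relations codes the point, so [A] and [B] may overlap. *)
Lemma card_leU_bool {T U : Type} {A B : set T} {C : set U} :
  A #<= C -> B #<= C -> A `|` B #<= C `*` [set: bool].
Proof.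
move=> /card_le_relP[R [Rtot Rinj]] /card_le_relP[S [Stot Sinj]].
apply/card_le_relP.
exists (fun x q => if q.2 then A x /\ R x q.1 else B x /\ S x q.1); split.
  move=> x [Ax|Bx].
    by have [c Cc Rxc] := Rtot _ Ax; exists (c, true).
  by have [c Cc Rxc] := Stot _ Bx; exists (c, false).
move=> x y [c []] /= _ _ [Cc _] [Xx Rx] [Xy Ry].
  exact: (Rinj _ _ c).
exact: (Sinj _ _ c).
Qed.

Lemma infinite_card_ge_bool {T : Type} {A : set T} : infinite_set A ->
  [set: bool] #<= A.
Proof.
by move=> /infiniteP; apply: card_le_trans; exact: countableP.
Qed.

(* Zorn's lemma is applied to graphs [G] of injections [D * D -> D] for
   [D] contained in [A], where [D] is recovered from [G] as
   [[set x | exists z, G (x, x, z)]]. *)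
Lemma card_le_square {T : Type} {A : set T} : infinite_set A ->
  A `*` A #<= A.
Proof.
move=> Ainf.
pose dm (G : set (T * T * T)) := [set x | exists z, G (x, x, z)].
pose P (G : set (T * T * T)) :=
  [/\ forall x y z, G (x, y, z) -> [/\ A x, dm G x, dm G y & dm G z],
      forall x y, dm G x -> dm G y -> exists z, G (x, y, z) &
      forall p q z, G (p, z) -> G (q, z) -> p = q].
have dmS G H : G `<=` H -> dm G `<=` dm H.
  by move=> GH x [z Gz]; exists z; exact: GH.
have [|G [[Gdm Gtot Ginj] Gmax]] := @Zorn_bigcup _ P.
  move=> F FP Ftot; split.
  - move=> x y z [G FG Gp]; have [Gdm _ _] := FP _ FG.
    have [Ax dx dy dz] := Gdm _ _ _ Gp.
    by split=> //; apply: (dmS G) => //; exact: bigcup_sup.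
  - move=> x y [u [G FG Gx]] [v [H FH Hy]].
    have [GH|HG] := Ftot _ _ FG FH.
      have [_ Htot _] := FP _ FH; have [||z Hz] := Htot x y.
      + by exists u; exact: GH.
      + by exists v.
      by exists z; exists H.
    have [_ Gtot _] := FP _ FG; have [||z Gz] := Gtot x y.
    + by exists u.
    + by exists v; exact: HG.
    by exists z; exists G.
  - move=> p q z [G FG Gp] [H FH Hq].
    have [GH|HG] := Ftot _ _ FG FH.
      by have [_ _ Hinj] := FP _ FH; apply: (Hinj _ _ z) => //; exact: GH.
    by have [_ _ Ginj] := FP _ FG; apply: (Ginj _ _ z) => //; exact: HG.
set D := dm G.
have DA : D `<=` A by move=> x [z /Gdm[]].
have DD : D `*` D #<= D.
  apply/card_le_relP; exists (fun p z => G (p, z)); split.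
    by move=> [x y] [/= Dx Dy]; have [z Gz] := Gtot _ _ Dx Dy; exists z => //;
       have [] := Gdm _ _ _ Gz.
  by move=> p q z _ _ _; exact: Ginj.
(* A nonempty [E] outside [D] absorbing all pairs over the union of [D] and [E] would enlarge [G]:
   the new pairs get values in [E], which never clash with the old values in [D]. *)
have noext E : E `<=` A `\` D -> E !=set0 ->
    ~ ((D `|` E) `*` (D `|` E) #<= E).
  move=> ED [e Ee] /card_le_relP[R [Rtot Rinj]].
  pose N p := (D `|` E) p.1 /\ (D `|` E) p.2 /\ ~ (D p.1 /\ D p.2).
  pose G' : set (T * T * T) := [set q | G q \/ [/\ N q.1, E q.2 & R q.1 q.2]].
  have NP x y : (D `|` E) x -> (D `|` E) y -> ~ (D x /\ D y) ->
      exists2 z, E z & G' (x, y, z).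
    move=> Xx Xy nD; have [//|z Ez Rz] := Rtot (x, y).
    by exists z => //; right.
  have dG' : dm G' = D `|` E.
    apply/seteqP; split=> [x [z [Gz|[[/= Xx _] _ _]]]|x [[z Gz]|Ex]] //.
    - by left; exists z.
    - by exists z; left.
    - have [||[Dx _]|z _ Gz] := NP x x.
      + by right.
      + by right.
      + by have [] := ED _ Ex.
      by exists z.
  apply: (Gmax G').
    split; first by move=> p Gp; left.
    move=> G'G; have [_] := ED _ Ee; apply.
    by apply: (dmS _ _ G'G); rewrite dG'; right.
  have XA : D `|` E `<=` A by move=> x [/DA//|/ED[]].
  split.
  - move=> x y z; rewrite dG' => -[/Gdm[Ax Dx Dy Dz]|[[/= Xx [Xy _]] Ez _]].
      by split=> //; left.
    by split=> //; [exact: XA|right].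
  - move=> x y; rewrite dG' => Xx Xy.
    have [[Dx Dy]|nD] := pselect (D x /\ D y); last first.
      by have [z _ Gz] := NP _ _ Xx Xy nD; exists z.
    by have [z Gz] := Gtot _ _ Dx Dy; exists z; left.
  - have excl p q z : G (p, z) -> [/\ N q, E z & R q z] -> p = q.
      move: p => [x y] /Gdm[_ _ _ Dz] [_ Ez _].
      by have [] := ED _ Ez.
    move=> p q z [Gp|Np] [Gq|Nq].
    + exact: Ginj Gp Gq.
    + exact: excl Gp Nq.
    + by rewrite (excl _ _ _ Gq Np).
    + have [[Np1 [Np2 _]] Ez Rp] := Np; have [[Nq1 [Nq2 _]] _ Rq] := Nq.
      exact: (Rinj p q z).
(* If [D] is finite, a countably infinite [E] in the rest of [A] absorbs the countable set of pairs,
   against [noext]. *)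
have [Dfin|Dinf] := pselect (finite_set D).
  exfalso; have /infiniteP/card_subP[E Enat EAD] : infinite_set (A `\` D).
    by apply: infinite_setD.
  have [natE Enat'] := (card_eqPle _ _).1 Enat.
  apply: (noext E) => //.
    apply: infinite_setN0; apply/infiniteP; exact: Enat'.
  apply: (card_le_trans _ Enat').
  suff cX : countable (D `|` E) by exact: countableX.
  apply: card_le_trans (card_leU_bool (finite_set_countable Dfin) natE) _.
  by apply: countableX; exact: countableP.
have DbD : D `*` [set: bool] #<= D.
  by apply: card_le_trans DD; apply: card_leX => //; exact: infinite_card_ge_bool.
(* Either the rest of [A] fits in [D], and [A] is no larger than [D], or it contains a copy [E] of
   [D], which [noext] excludes. *)
have [ADD|/card_subP[E /card_eqPle[ED DE] EAD]] := card_le_total (A `\` D) D.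
  have AD : A #<= D.
    apply: card_le_trans DbD; rewrite -(setDKU DA).
    exact: card_leU_bool.
  apply: card_le_trans (card_leX AD AD) (card_le_trans DD _).
  exact: subset_card_le.
exfalso; apply: (noext E) => //.
  apply: infinite_setN0 => Efin; apply: Dinf; exact: card_le_finite Efin.
have XD : D `|` E #<= D by apply: card_le_trans DbD; exact: card_leU_bool.
exact: card_le_trans (card_leX XD XD) (card_le_trans DD DE).
Qed.

(** A point is coded by a code of some index [i] whose set contains it, paired with its code inside
    [F i]; [card_le_square] absorbs the pair. *)
Lemma card_le_bigcup {I T U : Type} {D : set I} {F : I -> set T} {C : set U} :
  infinite_set C -> D #<= C -> (forall i, D i -> F i #<= C) ->
  \bigcup_(i in D) F i #<= C.
Proof.
move=> Cinf /card_le_relP[R [Rtot Rinj]] FC.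
apply: card_le_trans (card_le_square Cinf).
have {}FC i : exists S : T -> U -> Prop, D i ->
    (forall a, F i a -> exists2 b, C b & S a b) /\
    (forall a a' b, F i a -> F i a' -> C b -> S a b -> S a' b -> a = a').
  have [Di|nDi] := pselect (D i); last by exists (fun _ _ => False).
  by have /card_le_relP[S SP] := FC _ Di; exists S.
have [S SP] := choice FC.
apply/card_le_relP.
exists (fun x c => exists i, [/\ D i, F i x, R i c.1 & S i x c.2]); split.
  move=> x [i Di Fx]; have [c1 Cc1 Rc] := Rtot _ Di.
  have [c2 Cc2 Sc] := (SP _ Di).1 _ Fx.
  by exists (c1, c2) => //; exists i.
move=> x y [c1 c2] _ _ [/= Cc1 Cc2] [i [Di Fx Ri Sx]] [j [Dj Fy Rj Sy]].
have ij : i = j by exact: (Rinj _ _ c1).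
by subst j; exact: ((SP _ Di).2 _ _ c2).
Qed.

Lemma card_le_finite_infinite {T U : Type} {A : set T} {B : set U} :
  finite_set A -> infinite_set B -> A #<= B.
Proof. by move=> /finite_set_countable + /infiniteP; exact: card_le_trans. Qed.

Lemma card_leX_bool {T : Type} {A : set T} : infinite_set A ->
  A `*` [set: bool] #<= A.
Proof.
move=> Ainf; apply: card_le_trans (card_le_square Ainf).
by apply: card_leX => //; exact: infinite_card_ge_bool.
Qed.

Lemma card_leU {T U : Type} {A B : set T} {C : set U} : infinite_set C ->
  A #<= C -> B #<= C -> A `|` B #<= C.
Proof.
move=> Cinf leAC leBC; apply: card_le_trans (card_leU_bool leAC leBC) _.
exact: card_leX_bool.
Qed.

(** [A] is covered by the difference and [B]. Were the difference no larger than [B], then [A] would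
    be finite or fit in [B]; so [B] is the smaller part and is absorbed. *)
Lemma card_setD_lt {T : Type} {A B : set T} :
  infinite_set A -> ~ (A #<= B) -> A `\` B #= A.
Proof.
move=> Ainf nAB; apply/card_eqPle; split; first exact: card_le_setD.
have AU : A `<=` (A `\` B) `|` B.
  by move=> x Ax; have [Bx|nBx] := pselect (B x); [right|left].
have [ABB|BAB] := card_le_total (A `\` B) B.
  exfalso; apply: nAB; have [Bfin|Binf] := pselect (finite_set B).
    exfalso; apply: Ainf; apply: sub_finite_set AU _.
    by rewrite finite_setU; split=> //; exact: card_le_finite Bfin.
  by apply: card_le_trans (subset_card_le AU) _; exact: card_leU.
have Dinf : infinite_set (A `\` B).
  move=> Dfin; apply: Ainf; apply: sub_finite_set AU _.
  by rewrite finite_setU; split=> //; exact: card_le_finite Dfin.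
by apply: card_le_trans (subset_card_le AU) _; exact: card_leU.
Qed.

Lemma card_nle_lt {T U : Type} {A : set T} {B : set U} :
  ~ (A #<= B) -> card_lt B A.
Proof. by move=> nAB; split=> //; case: (card_le_total A B). Qed.

(* If [S `<=` U] is too large to fit in a member of the chain [G], then the
   members of [G] meeting [S] already cover [U]. *)
Lemma chain_bigcup_card_succ {T U : Type} {A : set U} {G : set (set T)} :
  infinite_set A -> total_on G subset -> (forall X, G X -> X #<= A) ->
  ~ (\bigcup_(X in G) X #<= A) -> card_succ A (\bigcup_(X in G) X).
Proof.
move=> Ainf Gtot GA nUA; set W := \bigcup_(X in G) X in nUA *.
split; first exact: card_nle_lt.
move=> V C [leAC nCA]; have [//|/card_subP[S SC SW]] := card_le_total W C.
have [_ CS] := (card_eqPle _ _).1 SC.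
have Cinf : infinite_set C by move=> Cfin; apply: Ainf; exact: card_le_finite Cfin.
have SWf s : exists X, S s -> G X /\ X s.
  have [Ss|nSs] := pselect (S s); last by exists set0.
  by have [X GX Xs] := SW _ Ss; exists X.
have [f fP] := choice SWf.
apply: card_le_trans (card_le_bigcup (D := S) (F := f) Cinf _ _).
- apply: subset_card_le => x [X GX Xx].
  have /existsNP[s /not_implyP[Ss nXs]] : ~ (S `<=` X).
    move=> SX; apply: nCA; apply: card_le_trans CS _.
    exact: card_le_trans (subset_card_le SX) (GA _ GX).
  have [Gf fs] := fP _ Ss.
  exists s => //; have [Xf|fX] := Gtot _ _ GX Gf; first exact: Xf.
  by have := fX _ fs.
- by case/card_eqPle: SC.
- by move=> s /fP[Gf _]; exact: card_le_trans (GA _ Gf) leAC.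
Qed.

(** * Jumps and weights *)

Lemma card_succ_eqr {T U V : Type} {A : set T} {B : set U} {C : set V} :
  B #= C -> card_succ A B -> card_succ A C.
Proof.
move=> /card_eqPle[leBC leCB] [[AB nBA] Bmin]; split; first split.
- exact: card_le_trans AB leBC.
- by move=> CA; apply: nBA; exact: card_le_trans leBC CA.
- by move=> W D /Bmin; exact: card_le_trans leCB.
Qed.

Lemma card_succ_infinite {T U : Type} {A : set T} {B : set U} :
  infinite_set A -> card_succ A B -> infinite_set B.
Proof. by move=> Ainf [[AB _] _] Bfin; apply: Ainf; exact: card_le_finite Bfin. Qed.

Section Jumps.
Context {d : Order.disp_t} (L : orderType d).
Local Open Scope order_scope.
Local Open Scope classical_set_scope.

Definition jumps : set (L * L) :=
  [set p | p.1 < p.2 /\ `]p.1, p.2[%classic = set0].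

Definition jumps_in (X : set L) : set (L * L) :=
  [set p | [/\ jumps p, X p.1 & X p.2]].

Definition convex (X : set L) : Prop :=
  forall x y z, X x -> X y -> x <= z <= y -> X z.

Lemma jump_le p z : jumps p -> z <= p.1 \/ p.2 <= z.
Proof.
move=> [_ p0]; have [|lt1] := leP z p.1; first by left.
have [|lt2] := leP p.2 z; first by right.
have : `]p.1, p.2[%classic z by rewrite /= in_itv /= lt1 lt2.
by rewrite p0.
Qed.

(** Neither end of a jump lies strictly inside another jump, so overlapping jumps coincide. In
    particular, either end determines a jump. *)
Lemma jumps_eq p q : jumps p -> jumps q -> p.1 < q.2 -> q.1 < p.2 -> p = q.
Proof.
have half r s : jumps r -> jumps s -> r.1 < s.2 -> r.2 <= s.2 /\ r.1 <= s.1.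
  move=> Jr Js rs; have [|le2] := jump_le s.2 Jr; first by rewrite leNgt rs.
  by have [le1|] := jump_le r.1 Js; last by rewrite leNgt rs.
move=> Jp Jq pq qp; have [p2 p1] := half _ _ Jp Jq pq.
have [q2 q1] := half _ _ Jq Jp qp.
case: p q p1 p2 q1 q2 {Jp Jq pq qp} => [c e] [c' e'] /= p1 p2 q1 q2.
by congr pair; apply: le_anti; apply/andP.
Qed.

Lemma convex_Nyc (a : L) : convex `]-oo, a].
Proof.
by move=> x y z /=; rewrite !in_itv /= => _ ya /andP[_ /le_trans]; apply.
Qed.

Lemma convex_cy (a : L) : convex `[a, +oo[.
Proof.
move=> x y z /=; rewrite !in_itv /= !andbT => ax _ /andP[xz _].
exact: le_trans xz.
Qed.

Lemma jumps_in_Nyc a p : jumps_in `]-oo, a] p <-> jumps p /\ p.2 <= a.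
Proof.
rewrite /jumps_in /= !in_itv /=; split=> [[]//|[Jp le2]]; split=> //.
exact: le_trans (ltW Jp.1) le2.
Qed.

Lemma jumps_in_cy a p : jumps_in `[a, +oo[ p <-> jumps p /\ a <= p.1.
Proof.
rewrite /jumps_in /= !in_itv /= !andbT; split=> [[]//|[Jp le1]]; split=> //.
exact: le_trans le1 (ltW Jp.1).
Qed.

Lemma jumps_setU a : jumps = jumps_in `]-oo, a] `|` jumps_in `[a, +oo[.
Proof.
apply/seteqP; split=> [p Jp|p [[]|[]]//].
by have [le1|le2] := jump_le a Jp; [right; apply/jumps_in_cy
                                   |left; apply/jumps_in_Nyc].
Qed.

Lemma jumps_in_disj a p : jumps_in `]-oo, a] p -> ~ jumps_in `[a, +oo[ p.
Proof.
move=> /jumps_in_Nyc[[+ _] le2] /jumps_in_cy[_ le1]; rewrite ltNge.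
by rewrite (le_trans le2 le1).
Qed.

Section Weight.
Hypothesis dj : dense_jumps L.
Variable X : set L.
Hypothesis Xconv : convex X.

Lemma jump_between x y : X x -> X y -> x < y ->
  exists2 p, jumps_in X p & x <= p.1 /\ p.2 <= y.
Proof.
move=> Xx Xy xy; have [c [e [xc ce ey J]]] := dj xy.
exists (c, e) => //; split=> //=; apply: (Xconv Xx Xy).
  by rewrite xc (le_trans (ltW ce)).
by rewrite ey (le_trans xc (ltW ce)).
Qed.

Lemma weakly_dense_jumps : weakly_dense X (fst @` jumps_in X).
Proof.
split=> [_ [p [_ X1 _] <-]//|x y Xx Xy xy].
have [p Jp [xp py]] := jump_between Xx Xy xy.
exists p.1; first by exists p.
by rewrite xp (le_trans (ltW _) py); case: Jp => -[].
Qed.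

Lemma card_fst_jumps : fst @` jumps_in X #= jumps_in X.
Proof.
apply: inj_card_eq => p q; rewrite !inE => -[Jp _ _] [Jq _ _] pq.
by apply: jumps_eq => //; [rewrite pq; case: Jq|rewrite -pq; case: Jp].
Qed.

(* A weakly dense set contains one of the two ends of each jump. *)
Lemma jumps_card_le_bool D : weakly_dense X D -> jumps_in X #<= D `*` [set: bool].
Proof.
move=> [DX Dd]; pose J1 := [set p | jumps_in X p /\ D p.1].
pose J2 := [set p | jumps_in X p /\ D p.2].
apply: (@card_le_trans _ _ _ (J1 `|` J2)).
  apply: subset_card_le => p Jp; have [J X1 X2] := Jp.
  have [z Dz /andP[le1 le2]] := Dd _ _ X1 X2 J.1.
  have [z1|z2] := jump_le z J.
    by left; split=> //; rewrite (_ : p.1 = z)//; apply: le_anti; apply/andP.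
  by right; split=> //; rewrite (_ : p.2 = z)//; apply: le_anti; apply/andP.
apply: card_leU_bool; apply/card_le_relP.
  exists (fun p z => p.1 = z); split=> [p [_ D1]|]; first by exists p.1.
  move=> p q z [[Jp _ _] _] [[Jq _ _] _] _ <- qp.
  by apply: jumps_eq => //; [rewrite -qp; case: Jq|rewrite qp; case: Jp].
exists (fun p z => p.2 = z); split=> [p [_ D2]|]; first by exists p.2.
move=> p q z [[Jp _ _] _] [[Jq _ _] _] _ <- qp.
by apply: jumps_eq => //; [rewrite qp; case: Jp|rewrite -qp; case: Jq].
Qed.

Lemma jumps_card_le D : weakly_dense X D ->
  infinite_set D \/ infinite_set (jumps_in X) -> jumps_in X #<= D.
Proof.
move=> Dd inf; have JD := jumps_card_le_bool Dd.
have Dinf : infinite_set D.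
  case: inf => // Jinf Dfin; apply: Jinf; apply: card_le_finite JD _.
  by apply: finite_setX => //; exact: finite_finset.
exact: card_le_trans JD (card_leX_bool Dinf).
Qed.

Lemma min_weakly_dense_card D : min_weakly_dense X D -> infinite_set D ->
  D #= jumps_in X.
Proof.
move=> [Dd Dmin] Dinf; apply/card_eqPle; split.
  apply: card_le_trans (Dmin _ weakly_dense_jumps) _.
  exact: card_image_le.
by apply: jumps_card_le => //; left.
Qed.

Lemma min_weakly_dense_jumps : infinite_set (jumps_in X) ->
  min_weakly_dense X (fst @` jumps_in X).
Proof.
move=> Jinf; split; first exact: weakly_dense_jumps.
move=> D Dd; apply: card_le_trans (card_image_le _ _) _.
by apply: jumps_card_le => //; right.
Qed.

(** The left ends of jumps are weakly dense, and a weakly dense set contains an end of every jump,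
    so for infinite values the weight is the number of jumps. *)
Lemma weight_isE (U : Type) (A : set U) : infinite_set A ->
  weight_is X A <-> jumps_in X #= A.
Proof.
move=> Ainf; split=> [[D Dmin DA]|JA].
  have Dinf : infinite_set D by rewrite (eq_finite_set DA).
  by apply: card_eq_trans DA; rewrite card_eq_sym; exact: min_weakly_dense_card.
exists (fst @` jumps_in X); last exact: card_eq_trans card_fst_jumps JA.
by apply: min_weakly_dense_jumps; rewrite (eq_finite_set JA).
Qed.

Lemma weight_is_succE (U : Type) (A : set U) : infinite_set A ->
  weight_is_succ X A <-> card_succ A (jumps_in X).
Proof.
move=> Ainf; split=> [[D Dmin DA]|JA].
  apply: (card_succ_eqr _ DA); apply: min_weakly_dense_card => //.
  exact: (card_succ_infinite Ainf DA).
exists (fst @` jumps_in X).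
  by apply: min_weakly_dense_jumps; exact: (card_succ_infinite Ainf JA).
by apply: card_succ_eqr JA; rewrite card_eq_sym; exact: card_fst_jumps.
Qed.

End Weight.

(** Later proofs handle a maximal chain as an order embedding [g] of [L], with members indexed by
    [L]. The point [x0] is a default preimage for sets outside the range. *)
Lemma has_maximal_chain_isoP (x0 : L) (T : Type) (P : set (set T)) :
  has_maximal_chain_iso L P <->
  exists g : L -> set T,
    (forall x y, x <= y <-> g x `<=` g y) /\ maximal_chain P (range g).
Proof.
split=> [[C Cmax [f [fC finj fsurj] fle]]|[g [gle gmax]]].
  have gP x : exists A, C A /\ f A = x.
    by have [A CA fA] := fsurj x I; exists A.
  have [g {}gP] := choice gP; exists g.
  split=> [x y|].
    by have [Cx {1}<-] := gP x; have [Cy {1}<-] := gP y; rewrite fle.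
  rewrite (_ : range g = C)//; apply/seteqP; split=> [_ [x _ <-]|A CA].
    exact: (gP x).1.
  have [CA' fA'] := gP (f A); exists (f A) => //.
  by apply: finj => //; rewrite inE.
have ginj : injective g.
  by move=> x y gxy; apply: le_anti; apply/andP; split; apply/gle; rewrite gxy.
have [f fK] : exists f : set T -> L, forall x, f (g x) = x.
  have gV A : exists x, range g A -> g x = A.
    have [[x _ <-]|] := pselect (range g A); first by exists x.
    by exists x0.
  have [f fP] := choice gV.
  by exists f => x; apply: ginj; rewrite fP//; exists x.
exists (range g) => //; exists f; first split=> //.
- move=> A B; rewrite !inE => -[x _ <-] [y _ <-]; by rewrite !fK => ->.
- by move=> x _; exists (g x) => //; exists x.
- by move=> _ _ [x _ <-] [y _ <-]; rewrite !fK -gle.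
Qed.

End Jumps.

(** * Maximal chains of sets *)

Section SplitSets.
Variables (K Lam Mu : Type).
Hypotheses (Lam_inf : infinite_set [set: Lam]) (Mu_inf : infinite_set [set: Mu]).

Local Notation P := (split_sets K Lam Mu).

Lemma split_sets_convex (A B C : set K) :
  P A -> P C -> A `<=` B -> B `<=` C -> P B.
Proof.
move=> [/card_eqPle[A1 A2] /card_eqPle[A3 A4]].
move=> [/card_eqPle[C1 C2] /card_eqPle[C3 C4]] AB BC'.
split; apply/card_eqPle; split.
- exact: card_le_trans (subset_card_le BC') C1.
- exact: card_le_trans A2 (subset_card_le AB).
- by apply: card_le_trans _ A3; apply: subset_card_le; exact: subsetC.
- by apply: card_le_trans C4 _; apply: subset_card_le; exact: subsetC.
Qed.

Lemma split_sets_infinite (A : set K) :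
  P A -> infinite_set A /\ infinite_set (~` A).
Proof. by move=> [A1 A2]; rewrite (eq_finite_set A1) (eq_finite_set A2). Qed.

Lemma infinite_nle_set1 (A : set K) (x : K) : infinite_set A -> ~ (A #<= [set x]).
Proof. by move=> Ainf Ax; apply: Ainf; apply: card_le_finite Ax _; exact: finite_set1. Qed.

(** With [split_setsU1], this allows maximality to be tested on one-point changes; infinite sets
    absorb the point. *)
Lemma split_setsD1 (A : set K) x : P A -> P (A `\ x).
Proof.
move=> PA; have [Ainf _] := split_sets_infinite PA; case: PA => A1 A2; split.
  by apply: card_eq_trans A1; apply: card_setD_lt => //; exact: infinite_nle_set1.
case/card_eqPle: A2 => A2 A3; apply/card_eqPle; split.
  by rewrite setCD; apply: card_leU => //; exact: card_le_finite_infinite.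
by apply: card_le_trans A3 _; apply: subset_card_le; apply: subsetC; exact: subDsetl.
Qed.

Lemma split_setsU1 (A : set K) x : P A -> P (A `|` [set x]).
Proof.
move=> PA; have [_ Ainf] := split_sets_infinite PA; case: PA => A2 A1; split.
  case/card_eqPle: A2 => A2 A3; apply/card_eqPle; split.
    by apply: card_leU => //; exact: card_le_finite_infinite.
  by apply: card_le_trans A3 _; apply: subset_card_le; exact: subsetUl.
rewrite setCU; apply: card_eq_trans A1; apply: card_setD_lt => //.
exact: infinite_nle_set1.
Qed.

End SplitSets.

Section MaximalChain.
Context {d : Order.disp_t} (L : orderType d) (K : Type).
Variables (P : set (set K)) (g : L -> set K).
Hypothesis Pconv : forall A B C, P A -> P C -> A `<=` B -> B `<=` C -> P B.
Hypothesis PU1 : forall A x, P A -> P (A `|` [set x]).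
Hypothesis PD1 : forall A x, P A -> P (A `\ x).
Local Open Scope order_scope.
Local Open Scope classical_set_scope.
Hypothesis gle : forall x y, x <= y <-> g x `<=` g y.
Hypothesis gmax : maximal_chain P (range g).

Lemma chain_mem a : P (g a).
Proof. by case: gmax => gP _ _; apply: gP; exists a. Qed.

Lemma chain_total a b : g a `<=` g b \/ g b `<=` g a.
Proof. by have [/gle|/ltW/gle] := leP a b; [left|right]. Qed.

(** Adjoining [B] to the chain gives a chain inside [P], which maximality makes equal to the old
    one. *)
Lemma chain_saturated B : P B -> (forall a, B `<=` g a \/ g a `<=` B) ->
  exists a, g a = B.
Proof.
move=> PB Bcmp; have [gP _ gM] := gmax.
have E : range g `|` [set B] = range g.
  apply: gM; last exact: subsetUl.
    by move=> X [/gP|->].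
  move=> X Y [[a _ <-]|->] [[b _ <-]|->].
  - exact: chain_total.
  - by have [] := Bcmp a; [right|left].
  - exact: Bcmp.
  - by left.
have : (range g `|` [set B]) B by right.
by rewrite E => -[a _ <-]; exists a.
Qed.

Lemma chain_lt a b x : g b x -> ~ g a x -> a < b.
Proof. by move=> bx ax; rewrite ltNge; apply/negP => /gle/(_ _ bx). Qed.

(** The union of the members omitting [x] and the intersection of those containing it lie in [P] by
    convexity and are comparable with every member, so they are members. Every member omits or
    contains [x], hence falls on one side. *)
Lemma chain_jump x a b : ~ g a x -> g b x ->
  exists p, [/\ jumps p, a <= p.1, p.2 <= b, ~ g p.1 x & g p.2 x].
Proof.
move=> ax bx.
pose B0 := \bigcup_(z in [set z | ~ g z x]) g z.
pose B1 := \bigcap_(z in [set z | g z x]) g z.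
have [c cE] : exists c, g c = B0.
  apply: chain_saturated.
    apply: (Pconv (chain_mem a) (chain_mem b)); first exact: bigcup_sup.
    by apply: bigcup_sub => z /= zx; apply/gle/ltW; exact: chain_lt zx.
  move=> z; have [zx|zx] := pselect (g z x); last by right; exact: bigcup_sup.
  by left; apply: bigcup_sub => y /= yx; apply/gle/ltW; exact: chain_lt yx.
have [e eE] : exists e, g e = B1.
  apply: chain_saturated.
    apply: (Pconv (chain_mem a) (chain_mem b)); last exact: bigcap_inf.
    by apply: sub_bigcap => z /= zx; apply/gle/ltW; exact: chain_lt ax.
  move=> z; have [zx|zx] := pselect (g z x); first by left; exact: bigcap_inf.
  by right; apply: sub_bigcap => y /= yx; apply/gle/ltW; exact: chain_lt zx.
have cx : ~ g c x by rewrite cE => -[z].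
have ex : g e x by rewrite eE => z.
exists (c, e); split=> //=; last 2 first.
- by apply/gle; rewrite cE; exact: bigcup_sup.
- by apply/gle; rewrite eE; exact: bigcap_inf.
split; first exact: chain_lt cx.
rewrite -subset0 => z /=; rewrite in_itv /= => /andP[cz ze].
have [zx|zx] := pselect (g z x).
  by move: ze; rewrite ltNge => /negP; apply; apply/gle; rewrite eE; exact: bigcap_inf.
by move: cz; rewrite ltNge => /negP; apply; apply/gle; rewrite cE; exact: bigcup_sup.
Qed.

(** As no index lies inside the jump, [g p.1] with [x] added is comparable with every member and so
    is one. Its index is not below [p.1], so it contains [g p.2] and therefore [y]. *)
Lemma chain_jump_uniq p x y : jumps p ->
  ~ g p.1 x -> g p.2 x -> ~ g p.1 y -> g p.2 y -> x = y.
Proof.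
move=> Jp x1 x2 y1 y2; have c12 : g p.1 `<=` g p.2 by apply/gle/ltW; case: Jp.
have xU : g p.1 `|` [set x] `<=` g p.2 by move=> _ [/c12//|->].
have [m mE] : exists m, g m = g p.1 `|` [set x].
  apply: chain_saturated; first exact: PU1 (chain_mem _).
  move=> z; have [zle|zle] := jump_le z Jp.
    by right; apply: (subset_trans _ (@subsetUl _ _ _)); apply/gle.
  by left; apply: (subset_trans xU); apply/gle.
have [mle|mle] := jump_le m Jp.
  by exfalso; apply: x1; apply: ((gle _ _).1 mle); rewrite mE; right.
by have := (gle _ _).1 mle _ y2; rewrite mE => -[//|->].
Qed.

Lemma chain_weakly_boolean : weakly_boolean L.
Proof.
split=> [A [a0 Aa0] [b bub]|a b ab].
  (* Suprema are unions: the union over [A] lies in [P], being between [g a0] and [g b], and is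
     comparable with every member. *)
  have [s sE] : exists s, g s = \bigcup_(a in A) g a.
    apply: chain_saturated.
      apply: (Pconv (chain_mem a0) (chain_mem b)); first exact: bigcup_sup.
      by apply: bigcup_sub => a /bub /gle.
    move=> z; have [zub|/existsNP[a /not_implyP[Aa za]]] := pselect (ubound A z).
      by left; apply: bigcup_sub => a /zub /gle.
    right; apply: (@subset_trans _ (g a)); last exact: bigcup_sup.
    by apply/gle; rewrite leNgt; apply/negP => /ltW.
  exists s; split=> [a Aa|c cub].
    by apply/gle; rewrite sE; exact: bigcup_sup.
  by apply/gle; rewrite sE; apply: bigcup_sub => a /cub /gle.
have [x [bx ax]] : exists x, g b x /\ ~ g a x.
  apply: contrapT => /forallNP nx; move: ab; rewrite ltNge => /negP; apply.
  apply/gle => x bx; apply: contrapT => ax; exact: (nx x).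
have [[c e] [[ce J] ac eb _ _]] := chain_jump ax bx.
by exists c, e.
Qed.

(** A jump is matched with the point added across it. Each jump adds some point, and only one by
    [chain_jump_uniq]; a point is added at only one jump by [jumps_eq]; convexity keeps that jump
    inside [X]. *)
Lemma chain_jumps_in X : convex X ->
  jumps_in X #= [set x | exists a b, [/\ X a, X b, ~ g a x & g b x]].
Proof.
move=> Xconv; apply/card_eqPle; split; apply/card_le_relP.
  exists (fun p x => ~ g p.1 x /\ g p.2 x); split.
    move=> p [Jp X1 X2].
    have [x [x2 x1]] : exists x, g p.2 x /\ ~ g p.1 x.
      apply: contrapT => /forallNP nx; case: Jp; rewrite ltNge => /negP + _; apply.
      apply/gle => x x2; apply: contrapT => x1; exact: (nx x).
    by exists x => //; exists p.1, p.2.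
  move=> p q x [Jp _ _] [Jq _ _] _ [p1 p2] [q1 q2].
  apply: jumps_eq => //; first exact: chain_lt p1.
  exact: chain_lt q1.
exists (fun x p => ~ g p.1 x /\ g p.2 x); split.
  move=> x [a [b [Xa Xb ax bx]]]; have [p [Jp ap pb x1 x2]] := chain_jump ax bx.
  have p12 : p.1 < p.2 by case: Jp.
  exists p => //; split=> //; apply: (Xconv a b) => //.
    by rewrite ap (le_trans (ltW p12)).
  by rewrite pb (le_trans ap (ltW p12)).
by move=> x y p _ _ [Jp _ _] [? ?] [? ?]; exact: (chain_jump_uniq Jp).
Qed.

Lemma chain_jumps_Nyc a :
  jumps_in `]-oo, a] #= g a `\` \bigcap_b g b.
Proof.
apply: card_eq_trans (chain_jumps_in (@convex_Nyc _ _ a)) _.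
rewrite (_ : mkset _ = g a `\` \bigcap_b g b); first exact: card_eqxx.
apply/seteqP; split=> [x [b [c []]] /=|x [ax /existsNP[b /not_implyP[_ bx]]]].
  rewrite !in_itv /= => ba ca bx cx; split; first exact: ((gle _ _).1 ca).
  by move=> /(_ b I).
exists b, a; split=> //=; rewrite in_itv //=.
by apply/ltW; exact: chain_lt bx.
Qed.

Lemma chain_jumps_cy a :
  jumps_in `[a, +oo[ #= (\bigcup_b g b) `\` g a.
Proof.
apply: card_eq_trans (chain_jumps_in (@convex_cy _ _ a)) _.
rewrite (_ : mkset _ = (\bigcup_b g b) `\` g a); first exact: card_eqxx.
apply/seteqP; split=> [x [b [c []]] /=|x [[b _ bx] ax]].
  rewrite !in_itv /= !andbT => ba ca bx cx; split; first by exists c.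
  by move=> ax; apply: bx; exact: ((gle _ _).1 ba).
exists a, b; split=> //=; rewrite in_itv //= ?andbT//.
by apply/ltW; exact: chain_lt ax.
Qed.

(** Were the intersection in [P], so would be the intersection without [x]; lying below every
    member, it would belong to the chain, whose members all contain [x]. *)
Lemma chain_bigcap_notin : (\bigcap_b g b) !=set0 -> ~ P (\bigcap_b g b).
Proof.
move=> [x Ix] PI.
have [m mE] : exists m, g m = (\bigcap_b g b) `\ x.
  apply: chain_saturated; first exact: PD1.
  by move=> a; left=> y [/(_ a I)].
by have [_ /(_ erefl)] : ((\bigcap_b g b) `\ x) x by rewrite -mE; exact: Ix.
Qed.

Lemma chain_bigcup_notin : ~` (\bigcup_b g b) !=set0 -> ~ P (\bigcup_b g b).
Proof.
move=> [x Ux] PU.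
have [m mE] : exists m, g m = (\bigcup_b g b) `|` [set x].
  apply: chain_saturated; first exact: PU1.
  by move=> a; right=> y ay; left; exists a.
by apply: Ux; exists m => //; rewrite mE; right.
Qed.

End MaximalChain.

(** The element [b] excludes an empty [U], into which no total function from a nonempty [T]
    exists. *)
Lemma card_le_fun {T U : Type} {A : set T} {B : set U} (b : U) : A #<= B ->
  exists2 f : T -> U, set_fun A B f & set_inj A f.
Proof.
elim/Ppointed: U => U in B b *; last by move=> /pcard_leP/injfunPex.
by have : [set: U] b by []; rewrite (empty_eq0 [set: U]).
Qed.

Lemma card_eq_fun {T U : Type} {A : set T} {B : set U} (b : U) : A #= B ->
  exists f : T -> U, set_bij A B f.
Proof.
elim/Ppointed: U => U in B b *; last by move=> /pcard_eqP/bijPex.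
by have : [set: U] b by []; rewrite (empty_eq0 [set: U]).
Qed.

(** If [Mu] were no larger than [Lam], the infinite [Lam] would absorb the sum and bound [K]; hence
    it is [Mu] that absorbs it. *)
Lemma card_lt_sum_ge {K Lam Mu : Type} :
  infinite_set [set: Lam] -> infinite_set [set: Mu] ->
  [set: K] #= [set: (Lam + Mu)%type] -> card_lt [set: Lam] [set: K] ->
  [set: K] #<= [set: Mu].
Proof.
move=> Lam_inf Mu_inf /card_eqPle[K_sum _] [_ nKLam].
have inlr : [set: (Lam + Mu)%type] = range inl `|` range inr.
  by apply/seteqP; split=> // -[x|x] _; [left|right]; exists x.
have l_le V (C : set V) : [set: Lam] #<= C -> range (@inl Lam Mu) #<= C.
  exact/card_le_trans/card_image_le.
have r_le V (C : set V) : [set: Mu] #<= C -> range (@inr Lam Mu) #<= C.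
  exact/card_le_trans/card_image_le.
apply: (card_le_trans K_sum); rewrite inlr.
have [LM|ML] := card_le_total [set: Lam] [set: Mu].
  by apply: card_leU => //; [exact: l_le|exact: r_le].
exfalso; apply: nKLam; apply: (card_le_trans K_sum); rewrite inlr.
by apply: card_leU => //; [exact: l_le|exact: r_le].
Qed.

Lemma card_sumC {K Lam Mu : Type} :
  [set: K] #= [set: (Lam + Mu)%type] -> [set: K] #= [set: (Mu + Lam)%type].
Proof.
move=> /card_eq_trans; apply; apply/card_eqPle.
by split; apply/card_le_relP;
  exists (fun x y => match x, y with
    | inl a, inr b => a = b | inr a, inl b => a = b | _, _ => False end);
  split=> [[a|a] _|[a|a] [b|b] [c|c] _ _ _ //= -> ->//];
  by [exists (inr a)|exists (inl a)].
Qed.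

Lemma setC_bigcap_setD {K I : Type} (g : I -> set K) a :
  g a `\` \bigcap_b g b = (\bigcup_b ~` g b) `\` ~` g a.
Proof. by rewrite !setDE setCK setC_bigcap setIC. Qed.

(** * Cardinals forced at the two ends of a maximal chain *)

Section ForwardCardinals.
Context {d : Order.disp_t} (L : orderType d) (K Lam Mu : Type).
Hypotheses (K_inf : infinite_set [set: K]).
Hypotheses (Lam_inf : infinite_set [set: Lam]) (Mu_inf : infinite_set [set: Mu]).
Variable g : L -> set K.
Local Notation P := (split_sets K Lam Mu).
Hypothesis gle : forall x y, (x <= y)%O <-> g x `<=` g y.
Hypothesis gmax : maximal_chain P (range g).

Let Pconv := @split_sets_convex K Lam Mu.
Let PU1 := @split_setsU1 K Lam Mu Lam_inf Mu_inf.
Let PD1 := @split_setsD1 K Lam Mu Lam_inf Mu_inf.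
Let gP := chain_mem gmax.

(** The intersection lies inside [g a], so its size is at most [Lam] and its co-size at least [Mu].
    Both reverse inequalities would place it in [P], which [chain_bigcap_notin] forbids. *)
Lemma bigcap_small (a : L) :
  ~ ([set: Lam] #<= \bigcap_b g b) \/ ~ (~` (\bigcap_b g b) #<= [set: Mu]).
Proof.
apply: contrapT => /not_orP[/contrapT leI /contrapT leCI].
have [/card_eqPle[ga1 ga2] /card_eqPle[ga3 ga4]] := gP a.
have Ia : \bigcap_b g b `<=` g a by exact: bigcap_inf.
apply: (chain_bigcap_notin PD1 gle gmax).
  apply: infinite_setN0 => Ifin; apply: Lam_inf; exact: card_le_finite Ifin.
split; apply/card_eqPle; split=> //.
  exact: card_le_trans (subset_card_le Ia) ga1.
by apply: card_le_trans ga4 _; apply: subset_card_le; exact: subsetC.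
Qed.

Lemma bigcup_small (a : L) :
  ~ (\bigcup_b g b #<= [set: Lam]) \/ ~ ([set: Mu] #<= ~` (\bigcup_b g b)).
Proof.
apply: contrapT => /not_orP[/contrapT leU /contrapT leCU].
have [/card_eqPle[ga1 ga2] /card_eqPle[ga3 ga4]] := gP a.
have aU : g a `<=` \bigcup_b g b by exact: bigcup_sup.
apply: (chain_bigcup_notin PU1 gle gmax).
  apply: infinite_setN0 => Ufin; apply: Mu_inf; exact: card_le_finite Ufin.
split; apply/card_eqPle; split=> //.
  exact: card_le_trans ga2 (subset_card_le aU).
by apply: card_le_trans _ ga3; apply: subset_card_le; exact: subsetC.
Qed.

(** No complement exceeds [Mu] here, so the intersection is strictly below [Lam] and its removal
    from [g a] leaves [Lam] points. *)
Lemma jumps_Nyc_card (a : L) : [set: K] #<= [set: Mu] ->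
  jumps_in `]-oo, a]%classic #= [set: Lam].
Proof.
move=> KM; have [nLI|/(_ (card_le_trans (card_leT _) KM))//] := bigcap_small a.
apply: card_eq_trans (chain_jumps_Nyc Pconv PU1 gle gmax a) _.
have [ainf _] := split_sets_infinite Lam_inf Mu_inf (gP a).
have [ga _] := gP a; apply: (card_eq_trans _ ga); apply: card_setD_lt => // aI.
by apply: nLI; apply: card_le_trans aI; case/card_eqPle: ga.
Qed.

Lemma jumps_cy_card (a : L) : [set: K] #<= [set: Lam] ->
  jumps_in `[a, +oo[%classic #= [set: Mu].
Proof.
move=> KL; have [/(_ (card_le_trans (card_leT _) KL))//|nMU] := bigcup_small a.
apply: card_eq_trans (chain_jumps_cy Pconv PU1 gle gmax a) _.
have [_ ainf] := split_sets_infinite Lam_inf Mu_inf (gP a).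
(* The union minus [g a] becomes the complement of [g a] minus the complement of the union, so that
   a small set is removed from one of size [Mu]. *)
have [_ ga] := gP a; rewrite setDE setIC -[X in _ `&` X]setCK -setDE.
apply: (card_eq_trans _ ga); apply: card_setD_lt => // aI.
by apply: nMU; apply: card_le_trans aI; case/card_eqPle: ga.
Qed.

(** The members have size [Lam]. If the union were no larger, its complement would have size [K],
    against [bigcup_small]; so the union has successor size, which the removal of [g a] does not
    change. *)
Lemma jumps_cy_card_succ (a : L) :
  card_lt [set: Lam] [set: K] -> [set: K] #<= [set: Mu] ->
  card_succ [set: Lam] (jumps_in `[a, +oo[%classic).
Proof.
move=> [LK nKL] KM; set U := \bigcup_b g b.
have gaL b : g b #<= [set: Lam] by case: (gP b) => /card_eqPle[].
have nUL : ~ (U #<= [set: Lam]).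
  move=> UL; have [//|] := bigcup_small a; apply.
  have [_ /card_eqPle[_ MaC]] := gP a.
  apply: card_le_trans MaC (card_le_trans (card_leT _) _).
  have /card_eqPle[_] : [set: K] `\` U #= [set: K]; last by rewrite setTD.
  by apply: card_setD_lt => // KU; apply: nKL; exact: card_le_trans KU UL.
have sU : card_succ [set: Lam] U.
  have UE : U = \bigcup_(X in range g) X by rewrite bigcup_image.
  rewrite UE; apply: chain_bigcup_card_succ => //.
  - move=> _ _ [b _ <-] [c _ <-]; exact: (chain_total gle).
  - by move=> _ [b _ <-].
  - by rewrite -UE.
apply: card_succ_eqr sU; rewrite card_eq_sym.
apply: card_eq_trans (chain_jumps_cy Pconv PU1 gle gmax a) _.
apply: card_setD_lt; last by move=> Ua; apply: nUL; exact: card_le_trans Ua (gaL a).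
by move=> Ufin; apply: nUL; exact: card_le_finite_infinite.
Qed.

(** The argument of [jumps_cy_card_succ] for the chain of complements, whose union is the complement
    of the intersection. *)
Lemma jumps_Nyc_card_succ (a : L) :
  card_lt [set: Mu] [set: K] -> [set: K] #<= [set: Lam] ->
  card_succ [set: Mu] (jumps_in `]-oo, a]%classic).
Proof.
move=> [MK nKM] KL; pose W := \bigcup_b ~` g b.
have WE : ~` (\bigcap_b g b) = W by rewrite setC_bigcap.
have gaM b : ~` g b #<= [set: Mu] by case: (gP b) => _ /card_eqPle[].
have nWM : ~ (W #<= [set: Mu]).
  move=> WM; have [|] := bigcap_small a; last (by rewrite WE); apply.
  have [/card_eqPle[_ La] _] := gP a.
  apply: card_le_trans La (card_le_trans (card_leT _) _).
  have /card_eqPle[_] : [set: K] `\` W #= [set: K]; last by rewrite setTD -WE setCK.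
  by apply: card_setD_lt => // KW; apply: nKM; exact: card_le_trans KW WM.
have sW : card_succ [set: Mu] W.
  have WE' : W = \bigcup_(X in range (fun b => ~` g b)) X.
    by rewrite bigcup_image.
  rewrite WE'; apply: chain_bigcup_card_succ => //.
  - move=> _ _ [b _ <-] [c _ <-].
    by have [bc|cb] := chain_total gle b c; [right|left]; exact: subsetC.
  - by move=> _ [b _ <-].
  - by rewrite -WE'.
apply: card_succ_eqr sW; rewrite card_eq_sym.
apply: card_eq_trans (chain_jumps_Nyc Pconv PU1 gle gmax a) _.
rewrite setC_bigcap_setD.
apply: card_setD_lt; last by move=> Wa; apply: nWM; exact: card_le_trans Wa (gaM a).
by move=> Wfin; apply: nWM; exact: card_le_finite_infinite.
Qed.

End ForwardCardinals.

(** * The chain of jumps of a weakly Boolean order *)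

Section Construction.
Context {d : Order.disp_t} (L : orderType d) (K : Type).
Variables (P : set (set K)) (h : L * L -> K) (E : set K) (a0 : L).
Local Open Scope order_scope.
Local Open Scope classical_set_scope.

(** [E] pads all members with common points: it is taken empty when the complements are to have the
    size of [K], and to be everything outside the image of the jumps when they are to be smaller. *)
Definition jump_chain (a : L) : set K := E `|` h @` jumps_in `]-oo, a].

Hypothesis wbL : weakly_boolean L.
Hypothesis h_inj : set_inj (@jumps _ L) h.
Hypothesis h_E : forall p, jumps p -> ~ E (h p).
Hypothesis jump_chainP : forall a, P (jump_chain a).
Hypothesis P_low : forall B, P B -> ~ (B `<=` E).
Hypothesis P_high : forall B, P B -> ~ (E `|` h @` (@jumps _ L) `<=` B).

Lemma jump_chain_mem a p : jumps p -> jump_chain a (h p) <-> p.2 <= a.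
Proof.
move=> Jp; split=> [[/(h_E Jp)//|[q /jumps_in_Nyc[Jq qa] hqp]]|pa].
  by rewrite -(h_inj _ _ hqp) ?inE.
by right; exists p => //; apply/jumps_in_Nyc.
Qed.

Lemma jump_chain_le a b : a <= b <-> jump_chain a `<=` jump_chain b.
Proof.
split=> [ab x [Ex|[p /jumps_in_Nyc[Jp pa] <-]]|ab]; first by left.
  by apply/jump_chain_mem => //; exact: le_trans pa ab.
(* For [b < a], a jump between them has its image in [jump_chain a] but not in [jump_chain b]. *)
rewrite leNgt; apply/negP => /wbL.2[c [e [bc ce ea J]]].
have Jce : jumps (c, e) by [].
have /ab/(jump_chain_mem _ Jce)/= eb : jump_chain a (h (c, e)).
  exact/(jump_chain_mem _ Jce).
by have := lt_le_trans ce (le_trans eb bc); rewrite ltxx.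
Qed.

(* [B] is the member of the chain indexed by [sup {a | jump_chain a `<=` B}]. *)
Lemma jump_chain_saturated B : P B ->
  (forall a, B `<=` jump_chain a \/ jump_chain a `<=` B) ->
  range jump_chain B.
Proof.
move=> PB Bcmp; pose T := [set a | jump_chain a `<=` B].
have nT a : ~ T a -> B `<=` jump_chain a by have [|] := Bcmp a.
(* Otherwise [B] lies in every [jump_chain a], and these intersect in [E]: the image of a jump [p]
   is missing at index [p.1]. *)
have [t Tt] : T !=set0.
  apply: contrapT => /forallNP T0; apply: (P_low PB) => x Bx.
  have x_ a : jump_chain a x by exact: nT (T0 a) _ Bx.
  have [//|[p /jumps_in_Nyc[Jp _] hp]] := x_ a0.
  have := x_ p.1; rewrite -hp => /(jump_chain_mem _ Jp).
  by rewrite leNgt Jp.1.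
have [u Tu] : exists u, ~ T u.
  apply: contrapT => /forallNP T1; apply: (P_high PB) => x.
  have {}T1 a : T a by apply: contrapT; exact: T1.
  move=> [Ex|[p Jp <-]]; first by apply: (T1 t); left.
  by apply: (T1 p.2); exact/jump_chain_mem.
have Tub b : ~ T b -> ubound T b.
  move=> nTb a Ta; rewrite leNgt; apply/negP => ba; apply: nTb.
  by apply: subset_trans Ta; exact/jump_chain_le/ltW.
have [s [sub slb]] : supremums T !=set0.
  by apply: wbL.1; [exists t|exists u; exact: Tub].
exists s => //; apply/seteqP; split=> [x [Ex|[p /jumps_in_Nyc[Jp ps] <-]]|x Bx].
- by apply: Tt; left.
(* Since [p.1] is below the supremum [s], it does not bound [T]; an element of [T] above [p.1] is at
   least [p.2]. *)
- have [a Ta pa] : exists2 a, T a & p.1 < a.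
    apply: contrapT => /forall2NP nTa.
    have /slb : ubound T p.1.
      by move=> a Ta; have [|/negP] := nTa a; rewrite // -leNgt.
    by rewrite leNgt (lt_le_trans Jp.1 ps).
  apply: Ta; apply/jump_chain_mem => //.
  by have [|//] := jump_le a Jp; rewrite leNgt pa.
- apply: contrapT => nsx; have [Ex|[p /jumps_in_Nyc[Jp _] hp]] := nT _ Tu _ Bx.
    by apply: nsx; left.
  subst x; have ps : s < p.2.
    by rewrite ltNge; apply/negP => /(jump_chain_mem _ Jp).
  have [sp|] := jump_le s Jp; last by rewrite leNgt ps.
  have nTp2 : ~ T p.2.
    by move=> /sub; rewrite leNgt ps.
  (* If [p.1] is outside [T], then [B] lies in [jump_chain p.1], which omits [h p]. Otherwise
     [jump_chain p.2] adds only [h p] to [jump_chain p.1], so [p.2] is in [T] too. *)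
  have [Tp|/nT/(_ _ Bx)/(jump_chain_mem _ Jp)] := pselect (T p.1); last first.
    by rewrite leNgt Jp.1.
  apply: nTp2 => y [Ey|[q /jumps_in_Nyc[Jq qp] <-]]; first by apply: Tt; left.
  have [qp1|pq] := jump_le q.2 Jp; first by apply: Tp; exact/jump_chain_mem.
  rewrite (jumps_eq Jq Jp) //; first exact: lt_le_trans Jq.1 qp.
  exact: lt_le_trans Jp.1 pq.
Qed.

Lemma jump_chain_maximal : has_maximal_chain_iso L P.
Proof.
apply/(has_maximal_chain_isoP a0); exists jump_chain; split.
  exact: jump_chain_le.
split=> [_ [a _ <-]//|_ _ [a _ <-] [b _ <-]|C CP Ctot rC].
  by have [/jump_chain_le|/ltW/jump_chain_le] := leP a b; [left|right].
apply/seteqP; split=> // B CB; apply: jump_chain_saturated; first exact: CP.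
by move=> a; apply: Ctot => //; apply: rC; exists a.
Qed.

End Construction.

(** * Transport of maximal chains along poset isomorphisms *)

Lemma poset_iso_sym {T U : Type} {A : set T} {rA : T -> T -> Prop} {B : set U}
    {rB : U -> U -> Prop} (t : T) : poset_iso A rA B rB -> poset_iso B rB A rA.
Proof.
move=> [f [fAB finj fsurj] fr].
have gP u : exists x, B u -> A x /\ f x = u.
  have [Bu|nBu] := pselect (B u); last by exists t.
  by have [x Ax fx] := fsurj u Bu; exists x.
have [g {}gP] := choice gP; exists g.
  split=> [u /gP[]//|u v|x Ax].
    by rewrite !inE => /gP[_ {2}<-] /gP[_ {2}<-] ->.
  have [Agx fgx] := gP _ (fAB _ Ax); exists (f x); first exact: fAB.
  by apply: finj => //; rewrite inE.
move=> u v /gP[Agu {1}<-] /gP[Agv {1}<-].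
by rewrite -fr.
Qed.

(** A chain in [Q] extending the image pulls back along [f] to a chain in [P] extending [range g],
    hence equal to it. *)
Lemma has_maximal_chain_poset_iso {d : Order.disp_t} {L : orderType d} (a : L)
    {T U : Type} {P : set (set T)} {Q : set (set U)} :
  poset_iso P subset Q subset ->
  has_maximal_chain_iso L P -> has_maximal_chain_iso L Q.
Proof.
move=> [f [fPQ finj fsurj] fle] /(has_maximal_chain_isoP a)[g [gle [gP gtot gM]]].
apply/(has_maximal_chain_isoP a); exists (f \o g).
have gmem x : P (g x) by apply: gP; exists x.
have fgle x y : (x <= y)%O <-> f (g x) `<=` f (g y) by rewrite -fle.
split=> //; split=> [_ [x _ <-]|_ _ [x _ <-] [y _ <-]|C CQ Ctot rC].
- exact: fPQ.
- by have [/fgle|/ltW/fgle] := leP x y; [left|right].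
have E : [set A | P A /\ C (f A)] = range g.
  apply: gM => [A []//|A B [PA CA] [PB CB]|_ [x _ <-]].
    by have [/fle|/fle] := Ctot _ _ CA CB; [left|right]; auto.
  by split=> //; apply: rC; exists x.
apply/seteqP; split=> // B CB; have [A PA fA] := fsurj _ (CQ _ CB).
have : [set A | P A /\ C (f A)] A by split=> //; rewrite fA.
by rewrite E => -[x _ gx]; exists x; rewrite //= gx.
Qed.

(** * Topologies coding sets *)

Section SplitTopology.
Variable K : Type.
Implicit Types A B : set K.

Definition trace_opens A : set (set K) := [set U | U `<=` A \/ U = setT].

Lemma trace_opens_full A : trace_opens A setT.
Proof. by right. Qed.

Lemma trace_opens_inter A : setI_closed (trace_opens A).
Proof.
move=> U V [UA _|->]; first by left=> x [/UA].
by rewrite setTI.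
Qed.

Lemma trace_opens_bigcup A (F : set (set K)) : F `<=` trace_opens A ->
  trace_opens A (\bigcup_(U in F) U).
Proof.
move=> FA; have [FT|nFT] := pselect (F setT).
  by right; apply/seteqP; split=> // x _; exists setT.
left; apply: bigcup_sub => U FU; have [//|UT] := FA _ FU.
by rewrite UT in FU.
Qed.

Definition trace_topology A : topology K :=
  Topology (@trace_opens_full A) (@trace_opens_inter A)
    (@trace_opens_bigcup A).

Lemma trace_opens_le A B : B <> setT -> A <> setT ->
  A `<=` B <-> trace_opens A `<=` trace_opens B.
Proof.
move=> nBT nAT; split=> [AB U [UA|->]|AB]; last by have [|//] := AB A (or_introl (fun=> id)).
  by left; exact: subset_trans UA AB.
by right.
Qed.

(** A left inverse of [trace_opens] on proper subsets. The full set is left out because it is open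
    whatever [A] is. *)
Definition untrace (O : set (set K)) : set K :=
  \bigcup_(U in O `\ setT) U.

Lemma trace_opensK A : A <> setT -> untrace (trace_opens A) = A.
Proof.
move=> nAT; apply/seteqP; split=> [x [U [[UA|->] nU]]|x Ax]; [exact: UA|by case: nU|].
by exists A => //; split=> //; left.
Qed.

Lemma homeomorphic_trace (s : topology K) A : homeomorphic s (trace_topology A) ->
  exists2 f : K -> K, bijective f & opens s = trace_opens (f @^-1` A).
Proof.
move=> [f [g [fK gK /continuousP fc /continuousP gc]]].
exists f; first by exists g.
apply/seteqP; split=> [V sV|V].
  have [VA|VT] : trace_opens A (g @^-1` V) := gc V sV; [left|right].
    by move=> x Vx; apply: VA; rewrite /= fK.
  apply/seteqP; split=> // x _.
  have : (g @^-1` V) (f x) by rewrite VT.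
  by rewrite /= fK.
have Vf : f @^-1` (g @^-1` V) = V by apply/funext => x; rewrite /= fK.
move=> sV; rewrite -Vf; apply: fc; case: sV => [VA|->]; last by right.
by left=> y /= /VA; rewrite /= gK.
Qed.

Lemma trace_homeomorphic (f : K -> K) A : bijective f ->
  homeomorphic (trace_topology (f @^-1` A)) (trace_topology A).
Proof.
move=> [g fK gK]; exists f, g; split=> //; apply/continuousP => U [UA|->].
- by left=> x /UA.
- by right.
- by left=> y /UA; rewrite /= gK.
- by right.
Qed.

Lemma bijective_extend A B : A #= B -> ~` A #= ~` B ->
  exists2 f : K -> K, bijective f & f @^-1` B = A.
Proof.
(* An empty [K] has no point to give to [card_eq_fun]; the identity serves there. *)
have [[k _]|K0] := pselect (exists k : K, True); last first.
  move=> _ _; exists id; first by exists id.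
  by apply/funext => k; exfalso; apply: K0; exists k.
move=> /(card_eq_fun k)[f [fAB finj fsurj]] /(card_eq_fun k)[f' [f'AB f'inj f'surj]].
pose h x := if pselect (A x) then f x else f' x.
have hA x : A x -> h x = f x by rewrite /h; case: pselect.
have hNA x : ~ A x -> h x = f' x by rewrite /h; case: pselect.
have hB x : B (h x) <-> A x.
  split=> [|Ax]; last by rewrite hA //; exact: fAB.
  by move=> Bhx; apply: contrapT => nAx; apply: (f'AB x nAx); rewrite -hNA.
exists h; last by apply/funext => x; apply/propext/hB.
rewrite -setTT_bijective; split=> // [x y _ _ hxy|y _].
  have [Ax|nAx] := pselect (A x).
    have Ay : A y by apply/hB; rewrite -hxy; apply/hB.
    by apply: finj; rewrite ?inE // -hA // hxy hA.
  have nAy : ~ A y by move/hB; rewrite -hxy => /hB.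
  by apply: f'inj; rewrite ?inE // -hNA // hxy hNA.
have [By|nBy] := pselect (B y).
  by have [x Ax <-] := fsurj y By; exists x => //; exact: hA.
by have [x Ax <-] := f'surj y nBy; exists x => //; exact: hNA.
Qed.

(** Copies of the topology of [A] are the topologies of its preimages under permutations of [K], and
    by [bijective_extend] these preimages are all the sets with the size and co-size of [A]. *)
Lemma homeo_class_trace {Lam Mu : Type} {A} : split_sets K Lam Mu A ->
  homeo_class (trace_topology A) = trace_opens @` split_sets K Lam Mu.
Proof.
move=> [AL AM]; apply/seteqP; split=> [_ [s /= /homeomorphic_trace[f fbij sE] <-]|].
  exists (f @^-1` A); last by rewrite sE.
  have pre B : f @^-1` B #= B.
    have [g fK gK] := fbij; rewrite (_ : f @^-1` B = g @` B).
      by apply: inj_card_eq => x y _ _; exact: (can_inj gK).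
    apply/seteqP; split=> [x Bx|_ [y By <-]]; first by exists (f x).
    by rewrite /= gK.
  by split; [exact: card_eq_trans (pre _) AL|rewrite preimage_setC;
             exact: card_eq_trans (pre _) AM].
move=> _ [B [BL BM] <-].
have [||f fbij <-] := @bijective_extend B A.
- by apply: card_eq_trans BL _; rewrite card_eq_sym.
- by apply: card_eq_trans BM _; rewrite card_eq_sym.
by exists (trace_topology (f @^-1` A)) => //=; exact: trace_homeomorphic.
Qed.

(** An infinite [Mu] keeps every coded set proper, so that [untrace] recovers it. *)
Lemma homeo_class_poset_iso {Lam Mu : Type} {A} :
  infinite_set [set: Mu] -> split_sets K Lam Mu A ->
  poset_iso (homeo_class (trace_topology A)) subset (split_sets K Lam Mu) subset.
Proof.
move=> Mu_inf PA; rewrite (homeo_class_trace PA).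
have nT B : split_sets K Lam Mu B -> B <> setT.
  move=> [_ BM] BT; apply: Mu_inf; rewrite -(eq_finite_set BM) BT setCT.
  exact: finite_set0.
have trK B : split_sets K Lam Mu B -> untrace (trace_opens B) = B.
  by move=> /nT; exact: trace_opensK.
exists untrace; first split.
- by move=> _ [B PB <-]; rewrite trK.
- move=> O O'; rewrite !inE => -[B PB <-] [B' PB' <-]; by rewrite !trK // => ->.
- by move=> B PB; exists (trace_opens B); [exists B|exact: trK].
- move=> _ _ [B PB <-] [B' PB' <-]; rewrite !trK //.
  by rewrite (trace_opens_le (nT _ PB') (nT _ PB)).
Qed.

End SplitTopology.

(** The bijection with the sum carries the left summand to such a set and the right summand to its
    complement. *)
Lemma split_sets_nonempty {K Lam Mu : Type} : infinite_set [set: Lam] ->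
  [set: K] #= [set: (Lam + Mu)%type] -> split_sets K Lam Mu !=set0.
Proof.
move=> /infinite_setN0[l _] /(card_eq_fun (inl l))[f].
rewrite setTT_bijective => -[g fK gK].
have ginj : injective g by exact: can_inj gK.
exists (g @` range inl); split.
  rewrite image_comp; apply: inj_card_eq => x y _ _ /ginj; congruence.
rewrite (_ : ~` _ = g @` range inr).
  rewrite image_comp; apply: inj_card_eq => x y _ _ /ginj; congruence.
apply/seteqP; split=> [x nx|_ [_ [y _ <-] <-] [_ [z _ <-] /ginj//]].
exists (f x); rewrite ?fK //.
by case fx: (f x) => [z|z]; [exfalso; apply: nx; exists (f x); rewrite ?fK // fx|];
  exists z.
Qed.

(** * The three cases *)

Section Cases.
Context {d : Order.disp_t} (L : orderType d) (a0 : L) (K Lam Mu : Type).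
Hypotheses (K_inf : infinite_set [set: K]).
Hypotheses (Lam_inf : infinite_set [set: Lam]) (Mu_inf : infinite_set [set: Mu]).
Local Notation P := (split_sets K Lam Mu).

Let weight_Nyc U (A : set U) (a : L) : weakly_boolean L -> infinite_set A ->
  weight_is `]-oo, a]%classic A <-> jumps_in `]-oo, a]%classic #= A.
Proof. by move=> [_ dj]; apply: weight_isE => //; exact: convex_Nyc. Qed.

Let weight_cy U (A : set U) (a : L) : weakly_boolean L -> infinite_set A ->
  weight_is `[a, +oo[%classic A <-> jumps_in `[a, +oo[%classic #= A.
Proof. by move=> [_ dj]; apply: weight_isE => //; exact: convex_cy. Qed.

Let weight_succ_Nyc U (A : set U) (a : L) : weakly_boolean L -> infinite_set A ->
  weight_is_succ `]-oo, a]%classic A <-> card_succ A (jumps_in `]-oo, a]%classic).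
Proof. by move=> [_ dj]; apply: weight_is_succE => //; exact: convex_Nyc. Qed.

Let weight_succ_cy U (A : set U) (a : L) : weakly_boolean L -> infinite_set A ->
  weight_is_succ `[a, +oo[%classic A <-> card_succ A (jumps_in `[a, +oo[%classic).
Proof. by move=> [_ dj]; apply: weight_is_succE => //; exact: convex_cy. Qed.

Let chain_wb (g : L -> set K) : (forall x y, (x <= y)%O <-> g x `<=` g y) ->
  maximal_chain P (range g) -> weakly_boolean L.
Proof.
apply: chain_weakly_boolean; first exact: split_sets_convex.
Qed.

Let h_card (h : L * L -> K) X : set_inj (@jumps _ L) h -> X `<=` @jumps _ L ->
  h @` X #= X.
Proof.
move=> hinj XJ; apply: inj_card_eq => p q; rewrite !inE => /XJ Jp /XJ Jq.
by apply: hinj; rewrite inE.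
Qed.

Let jumps_card_le_K : (forall a : L, jumps_in `]-oo, a]%classic #<= [set: K]) ->
  (forall a : L, jumps_in `[a, +oo[%classic #<= [set: K]) ->
  exists h : L * L -> K, set_inj (@jumps _ L) h.
Proof.
move=> JN Jy; have [k _] := infinite_setN0 K_inf.
have [|h _ hinj] := @card_le_fun _ _ (@jumps _ L) [set: K] k; last by exists h.
by rewrite (jumps_setU a0); exact: card_leU.
Qed.

Let jumps_inC (h : L * L -> K) a : set_inj (@jumps _ L) h ->
  ~` (h @` jumps_in `]-oo, a]%classic) =
    ~` (h @` (@jumps _ L)) `|` h @` jumps_in `[a, +oo[%classic.
Proof.
move=> hinj; apply/seteqP; split=> [x nx|x].
  have [[p]|] := pselect ((h @` (@jumps _ L)) x); last by left.
  rewrite (jumps_setU a) => -[Jp|Jp] hp; last by right; exists p.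
  by exfalso; apply: nx; exists p.
move=> [nx [p [Jp _ _] hp]|[p Jp <-] [q Jq hqp]]; first by apply: nx; exists p.
apply: (@jumps_in_disj _ _ a q) => //.
by rewrite (hinj q p) // inE; [case: Jq|case: Jp].
Qed.

Lemma maximal_chain_balanced :
  [set: K] #= [set: Lam] -> [set: Lam] #= [set: Mu] ->
  has_maximal_chain_iso L P <->
  weakly_boolean L /\ forall a : L,
    weight_is `]-oo, a]%classic [set: K] /\ weight_is `[a, +oo[%classic [set: K].
Proof.
move=> KL LM; have KM := card_eq_trans KL LM.
split=> [/(has_maximal_chain_isoP a0)[g [gle gmax]]|[wb W]].
  have wb := chain_wb gle gmax; split=> // a; split.
    apply/weight_Nyc => //; apply: (@card_eq_trans _ _ _ _ [set: Lam]).
      apply: (jumps_Nyc_card Lam_inf Mu_inf gle gmax).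
      by case/card_eqPle: KM.
    by rewrite card_eq_sym.
  apply/weight_cy => //; apply: (@card_eq_trans _ _ _ _ [set: Mu]).
    apply: (jumps_cy_card Lam_inf Mu_inf gle gmax).
    by case/card_eqPle: KL.
  by rewrite card_eq_sym.
have JN (a : L) : jumps_in `]-oo, a]%classic #= [set: K].
  by apply/weight_Nyc => //; have [] := W a.
have Jy (a : L) : jumps_in `[a, +oo[%classic #= [set: K].
  by apply/weight_cy => //; have [] := W a.
have JK : @jumps _ L #= [set: K].
  apply/card_eqPle; split.
    by rewrite (jumps_setU a0); apply: card_leU => //;
       [case/card_eqPle: (JN a0)|case/card_eqPle: (Jy a0)].
  have /card_eqPle[_ /card_le_trans] := JN a0; apply.
  by apply: subset_card_le => p [].
have [k _] := infinite_setN0 K_inf.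
(* Here [h] is onto [K], so with [E] empty the complement of a member is the image of the jumps
   above its index, of size [K]. *)
have [h [_ hinj hsurj]] := card_eq_fun k JK.
have hT : h @` (@jumps _ L) = setT by apply/seteqP; split.
apply: (@jump_chain_maximal _ _ _ P h set0 a0) => // [p _ []|a|B PB|B PB].
- rewrite /jump_chain set0U; split.
    apply: card_eq_trans (h_card hinj _) (card_eq_trans (JN a) KL) => p; by case.
  rewrite (jumps_inC _ hinj) hT setCT set0U.
  apply: card_eq_trans (h_card hinj _) (card_eq_trans (Jy a) KM) => p; by case.
- have [/infinite_setN0[x Bx] _] := split_sets_infinite Lam_inf Mu_inf PB.
  by move=> /(_ _ Bx).
- have [_ /infinite_setN0[x Bx]] := split_sets_infinite Lam_inf Mu_inf PB.
  by rewrite set0U hT => /(_ x I).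
Qed.

(** In the converse the constructed members have size [Lam], below [K], so any injection of the
    jumps into [K] leaves complements of size [K]. No set in [P] contains all the images, as the
    jumps above [a0] alone outnumber [Lam]. *)
Lemma maximal_chain_small_Lam :
  card_lt [set: Lam] [set: K] -> [set: K] #= [set: Mu] ->
  has_maximal_chain_iso L P <->
  weakly_boolean L /\ forall a : L,
    weight_is `]-oo, a]%classic [set: Lam] /\
    weight_is_succ `[a, +oo[%classic [set: Lam].
Proof.
move=> LK KM; have KleM : [set: K] #<= [set: Mu] by case/card_eqPle: KM.
split=> [/(has_maximal_chain_isoP a0)[g [gle gmax]]|[wb W]].
  have wb := chain_wb gle gmax; split=> // a; split.
    by apply/weight_Nyc => //; exact: (jumps_Nyc_card Lam_inf Mu_inf gle gmax).
  by apply/weight_succ_cy => //;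
     exact: (jumps_cy_card_succ K_inf Lam_inf Mu_inf gle gmax).
have JN (a : L) : jumps_in `]-oo, a]%classic #= [set: Lam].
  by apply/weight_Nyc => //; have [] := W a.
have Jy (a : L) : card_succ [set: Lam] (jumps_in `[a, +oo[%classic).
  by apply/weight_succ_cy => //; have [] := W a.
have [LleK nKL] := LK.
have [||h hinj] := jumps_card_le_K.
- by move=> a; case/card_eqPle: (JN a) => + _; move/card_le_trans; apply.
(* [K] lies strictly above [Lam], so a successor of [Lam] is at most [K]. *)
- by move=> a; have [_] := Jy a; apply.
have hJN (a : L) : h @` jumps_in `]-oo, a]%classic #= [set: Lam].
  by apply: card_eq_trans (h_card hinj _) (JN a) => p; case.
apply: (@jump_chain_maximal _ _ _ P h set0 a0) => // [p _ []|a|B PB|B PB].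
- rewrite /jump_chain set0U; split=> //.
  apply: card_eq_trans KM; rewrite -setTD; apply: card_setD_lt => // KJ.
  by apply: nKL; apply: card_le_trans KJ _; case/card_eqPle: (hJN a).
- have [/infinite_setN0[x Bx] _] := split_sets_infinite Lam_inf Mu_inf PB.
  by move=> /(_ _ Bx).
- case: PB => /card_eqPle[BL _] _; rewrite set0U => JB.
  have [[_ nJL] _] := Jy a0; apply: nJL.
  have /card_eqPle[_ /card_le_trans] : h @` jumps_in `[a0, +oo[%classic #=
      jumps_in `[a0, +oo[%classic by apply: h_card => // p; case.
  apply; apply: card_le_trans BL; apply: subset_card_le.
  by apply: subset_trans JB; apply: image_subset => p; case.
Qed.

(** In the converse, padding with everything outside the image of [h] makes the complement of a
    member the image of the jumps above its index, of size [Mu]. A set of [P] inside the padding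
    would omit the images of the jumps below [a0], which outnumber [Mu]. *)
Lemma maximal_chain_small_Mu :
  card_lt [set: Mu] [set: K] -> [set: K] #= [set: Lam] ->
  has_maximal_chain_iso L P <->
  weakly_boolean L /\ forall a : L,
    weight_is_succ `]-oo, a]%classic [set: Mu] /\
    weight_is `[a, +oo[%classic [set: Mu].
Proof.
move=> MK KL; have KleL : [set: K] #<= [set: Lam] by case/card_eqPle: KL.
split=> [/(has_maximal_chain_isoP a0)[g [gle gmax]]|[wb W]].
  have wb := chain_wb gle gmax; split=> // a; split.
    by apply/weight_succ_Nyc => //;
       exact: (jumps_Nyc_card_succ K_inf Lam_inf Mu_inf gle gmax).
  by apply/weight_cy => //; exact: (jumps_cy_card Lam_inf Mu_inf gle gmax).
have JN (a : L) : card_succ [set: Mu] (jumps_in `]-oo, a]%classic).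
  by apply/weight_succ_Nyc => //; have [] := W a.
have Jy (a : L) : jumps_in `[a, +oo[%classic #= [set: Mu].
  by apply/weight_cy => //; have [] := W a.
have [MleK nKM] := MK.
have [||h hinj] := jumps_card_le_K.
- by move=> a; have [_] := JN a; apply.
- by move=> a; case/card_eqPle: (Jy a) => + _; move/card_le_trans; apply.
have hJy (a : L) : h @` jumps_in `[a, +oo[%classic #= [set: Mu].
  by apply: card_eq_trans (h_card hinj _) (Jy a) => p; case.
have cJ (a : L) : ~` jump_chain h (~` (h @` (@jumps _ L))) a =
    h @` jumps_in `[a, +oo[%classic.
  rewrite /jump_chain setCU setCK jumps_inC // setIUr setICr set0U.
  by apply/setIidPr/image_subset => p; case.
apply: (@jump_chain_maximal _ _ _ P h (~` (h @` (@jumps _ L))) a0) => //.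
- by move=> p Jp; apply; exists p.
- move=> a; split; last by rewrite cJ.
  rewrite -[jump_chain _ _ _]setCK cJ; apply: card_eq_trans KL.
  rewrite -setTD; apply: card_setD_lt => // KJ.
  by apply: nKM; apply: card_le_trans KJ _; case/card_eqPle: (hJy a).
- move=> B [_ /card_eqPle[BM _]] JB.
  have [[_ nJM] _] := JN a0; apply: nJM.
  have /card_eqPle[_ /card_le_trans] : h @` jumps_in `]-oo, a0]%classic #=
      jumps_in `]-oo, a0]%classic by apply: h_card => // p; case.
  apply; apply: card_le_trans BM; apply: subset_card_le.
  move=> x [p [Jp _ _] hp] /JB; apply; by exists p.
- move=> B PB; have [_ /infinite_setN0[x Bx]] := split_sets_infinite Lam_inf Mu_inf PB.
  by rewrite setUC setUv => /(_ x I).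
Qed.

End Cases.

Theorem theorem4p1 (K Lam Mu : Type)
    (K_inf : infinite_set [set: K])
    (Lam_inf : infinite_set [set: Lam])
    (Mu_inf : infinite_set [set: Mu])
    (K_sum : [set: K] #= [set: (Lam + Mu)%type]) :
  exists t : topology K,
    poset_iso (homeo_class t) subset (split_sets K Lam Mu) subset /\
    forall (d : Order.disp_t) (L : orderType d), [set: L] !=set0 ->
      [/\ [set: K] #= [set: Lam] /\ [set: Lam] #= [set: Mu] ->
          (has_maximal_chain_iso L (homeo_class t) <->
           weakly_boolean L /\
           forall a : L, weight_is `]-oo, a] [set: K] /\
                         weight_is `[a, +oo[ [set: K]),
          card_lt [set: Lam] [set: K] ->
          (has_maximal_chain_iso L (homeo_class t) <->
           weakly_boolean L /\
           forall a : L, weight_is `]-oo, a] [set: Lam] /\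
                         weight_is_succ `[a, +oo[ [set: Lam]) &
          card_lt [set: Mu] [set: K] ->
          (has_maximal_chain_iso L (homeo_class t) <->
           weakly_boolean L /\
           forall a : L, weight_is_succ `]-oo, a] [set: Mu] /\
                         weight_is `[a, +oo[ [set: Mu])].
Proof.
have [A PA] := split_sets_nonempty Lam_inf K_sum.
have iso := homeo_class_poset_iso Mu_inf PA.
exists (trace_topology A); split=> // d L [a0 _].
have -> : has_maximal_chain_iso L (homeo_class (trace_topology A)) =
    has_maximal_chain_iso L (split_sets K Lam Mu).
  apply/propext; split; apply: has_maximal_chain_poset_iso => //.
  exact: (poset_iso_sym set0).
have [LleK MleK] : [set: Lam] #<= [set: K] /\ [set: Mu] #<= [set: K].
  by case: PA => /card_eqPle[_ LA] /card_eqPle[_ MA]; split;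
     [exact: card_le_trans LA (card_leT _)|exact: card_le_trans MA (card_leT _)].
split=> [[KL LM]|LK|MK].
- exact: maximal_chain_balanced.
- apply: maximal_chain_small_Lam => //; apply/card_eqPle; split=> //.
  exact: (card_lt_sum_ge Lam_inf Mu_inf K_sum).
- apply: maximal_chain_small_Mu => //; apply/card_eqPle; split=> //.
  exact: (card_lt_sum_ge Mu_inf Lam_inf (card_sumC K_sum)).
Qed.
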